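(* The subshift $\sigma_{\{x,y\}}|\Omega(\xi_{\mathrm{pd}})$ is a two-to-one continuous factor of the subshift $\sigma_{\{0,1\}}|\Omega(\xi_{\mathrm{TM}})$. The subshift $\sigma_{\{a,c,d\}}|\Omega(\xi_{\mathrm{Mu}})$ is topologically conjugate to $\sigma_{\{x,y\}}|\Omega(\xi_{\mathrm{pd}})$.
   Context: An alphabet $\mathcal{A}$ is a finite set with more than one element; $\mathbb{N}=\{1,2,\dots\}$. $\mathcal{A}^{\mathbb{Z}}$ is the set of bi-infinite strings (functions $\mathbb{Z}\to\mathcal{A}$) with the product topology, $\mathcal{A}$ being discrete. The shift $\sigma_{\mathcal{A}}$ is given by $(\sigma_{\mathcal{A}}(\omega))(n)=\omega(n+1)$. For $\xi\in\mathcal{A}^{\mathbb{N}}$, $\Omega(\xi)$ is the set of all $\omega\in\mathcal{A}^{\mathbb{Z}}$ such that every (finite, nonempty, contiguous) subword of $\omega$ is also a subword of $\xi$; it is nonempty, closed and $\sigma_{\mathcal{A}}(\Omega(\xi))=\Omega(\xi)$; $\sigma_{\mathcal{A}}|\Omega(\xi)$ denotes the restriction of the shift. Substitutions are applied to strings letter by letter with concatenation. $\xi_{\mathrm{TM}}\in\{0,1\}^{\mathbb{N}}$ is the unique infinite string beginning with $0$ preserved by $0\to01$, $1\to10$; $\xi_{\mathrm{pd}}\in\{x,y\}^{\mathbb{N}}$ is the unique infinite string beginning with $x$ preserved by $x\to xy$, $y\to xx$; $\xi_{\mathrm{Mu}}\in\{a,c,d\}^{\mathbb{N}}$ is the unique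 infinite string beginning with $a$ preserved by $a\to aca$, $c\to d$, $d\to c$. Given homeomorphisms $T_1:X_1\to X_1$, $T_2:X_2\to X_2$ of topological spaces, $T_2$ is a continuous factor of $T_1$ if there is a continuous onto map $f:X_1\to X_2$ with $fT_1=T_2f$; it is a two-to-one continuous factor if $f$ can be chosen so that every point of $X_2$ has exactly two preimages; $T_2$ is topologically conjugate to $T_1$ if $f$ can be chosen to be a homeomorphism. *)

(* Defs.v *)
From HB Require Import structures.
From mathcomp Require Import all_boot all_order all_algebra.
From mathcomp Require Import all_classical topology.
Set Implicit Arguments.
Unset Strict Implicit.
Unset Printing Implicit Defensive.

Import GRing.Theory.
Local Open Scope classical_set_scope.
Local Open Scope ring_scope.

Section Dynamics.

Definition homeomorphism (X Y : topologicalType) (f : X -> Y) : Prop :=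
  continuous f /\
  exists g : Y -> X, [/\ continuous g, cancel f g & cancel g f].

(* In the following definitions [T1] and [T2] are meant to be homeomorphisms;
   see [subshift_homeomorphism] below for subshifts. *)
Context {X1 X2 : topologicalType} (T2 : X2 -> X2) (T1 : X1 -> X1).

Definition factor_map (f : X1 -> X2) : Prop :=
  [/\ continuous f, (forall y, exists x, f x = y) &
      forall x, f (T1 x) = T2 (f x)].

Definition two_to_one_continuous_factor : Prop :=
  exists f, factor_map f /\
    forall y, exists x x' : X1, x <> x' /\ f @^-1` [set y] = [set x; x'].

Definition topologically_conjugate : Prop :=
  exists f, factor_map f /\ homeomorphism f.

End Dynamics.

Definition bistring (A : finType) : Type := {ptws int -> discrete_topology A}.
HB.instance Definition _ (A : finType) := Topological.on (bistring A).

Section Subshift.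
Context {A : finType}.

(* Strings indexed by the positive integers are represented by functions on
   [nat]: the letter of index [n.+1] is [xi n]. *)
Implicit Types (xi : nat -> A) (om : bistring A) (w : seq A).

Definition shift om : bistring A := fun n => om (n + 1).

Definition subword_of_string w xi : Prop :=
  w <> [::] /\ exists k : nat, w = mkseq (fun i => xi (k + i)%N) (size w).

Definition subword_of_bistring w om : Prop :=
  w <> [::] /\ exists k : int, w = mkseq (fun i => om (k + i%:Z)) (size w).

Definition Omega xi : set (bistring A) :=
  [set om | forall w, subword_of_bistring w om -> subword_of_string w xi].

Lemma Omega_shift xi om : Omega xi om -> Omega xi (shift om).
Proof.
move=> h w [w0 [k wE]]; apply: h; split=> //; exists (k + 1); rewrite {1}wE.
by apply: eq_mkseq => i; rewrite /shift addrAC.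
Qed.

(* [Omega xi], seen as a type, carries the topology induced by [bistring A]. *)
Definition subshift xi (x : Omega xi) : Omega xi :=
  exist _ (shift (val x)) (mem_set (Omega_shift (set_mem (valP x)))).

Let unshift om : bistring A := fun n => om (n - 1).

Let Omega_unshift xi om : Omega xi om -> Omega xi (unshift om).
Proof.
move=> h w [w0 [k wE]]; apply: h; split=> //; exists (k - 1); rewrite {1}wE.
by apply: eq_mkseq => i; rewrite /unshift addrAC.
Qed.

Let reindex_continuous (g : int -> int) :
  continuous (fun om : bistring A => (fun n => om (g n)) : bistring A).
Proof.
pose P := {ptws int -> discrete_topology A}.
suff : continuous (fun om : P => (fun n => om (g n)) : P) by [].
move=> om.
have ? : Filter ((fun om : P => (fun n => om (g n)) : P) @ om).
  by apply: fmap_filter; exact: nbhs_filter.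
apply/cvg_sup => i; apply/cvg_image.
  by apply/seteqP; split=> // y _; exists (fun=> y).
move=> U nU.
exists (fun h : int -> A => U (h i)).
  exact: (@proj_continuous _ (fun=> discrete_topology A) (g i) om U nU).
by apply/seteqP; split=> [y [f /= Uf <-]//|y Uy]; exists (fun=> y).
Qed.

Let restrict_continuous xi (h : bistring A -> bistring A)
    (H : forall om, Omega xi om -> Omega xi (h om)) :
  continuous h ->
  continuous (fun x : Omega xi =>
    exist _ (h (val x)) (mem_set (H _ (set_mem (valP x)))) : Omega xi).
Proof.
move=> ch.
apply: (@continuous_comp_initial _ _ _ (set_val : Omega xi -> _)) => x.
apply: (@continuous_comp _ _ _ (set_val : Omega xi -> _) h); last exact: ch.
exact: initial_continuous.
Qed.

Lemma subshift_homeomorphism xi : homeomorphism (@subshift xi).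
Proof.
split.
  exact: (@restrict_continuous _ _ (@Omega_shift xi) (@reindex_continuous (+%R^~ 1))).
exists (fun x : Omega xi =>
  exist _ (unshift (val x)) (mem_set (@Omega_unshift _ _ (set_mem (valP x))))).
split.
- exact: (@restrict_continuous _ _ (@Omega_unshift xi)
    (@reindex_continuous (fun n => n - 1))).
- move=> x; apply: val_inj; apply/funext => n.
  by rewrite /= /unshift /shift subrK.
- move=> x; apply: val_inj; apply/funext => n.
  by rewrite /= /unshift /shift addrK.
Qed.

End Subshift.

Arguments subshift {A} xi x.

Local Open Scope nat_scope.

Section Substitution.
Context {A : finType}.
Implicit Types (s : A -> seq A) (xi eta : nat -> A) (a : A).

Definition subst_word s (w : seq A) : seq A := flatten (map s w).

(* The infinite concatenation s(xi 0) s(xi 1) s(xi 2)..., for [s] with nonempty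
   values: its letter at position [n] occurs in the image of the first [n.+1]
   letters of [xi], which has length at least [n.+1]. *)
Definition subst_string s xi : nat -> A :=
  fun n => nth (xi 0) (subst_word s (mkseq xi n.+1)) n.

Definition nonerasing s : bool := [forall a, s a != [::]].

Lemma size_subst_word s w : nonerasing s -> (size w <= size (subst_word s w)).
Proof.
move=> /forallP s0; rewrite /subst_word; elim: w => //= b w IHw.
by rewrite size_cat -add1n leq_add // lt0n size_eq0.
Qed.

Definition prolongable s a : bool :=
  [&& nonerasing s, ohead (s a) == Some a & (1 < size (s a))].

Let size_subst_word_prolongable s a w : prolongable s a ->
  (size (a :: w) < size (subst_word s (a :: w))).
Proof.
case/and3P=> s0 _ sa; rewrite /subst_word /= size_cat -[(size w).+2]add2n.
by rewrite leq_add ?size_subst_word.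
Qed.

Let subst_string_prefix s xi n : prolongable s (xi 0) ->
  subst_string s xi n.+1 = nth (xi 0) (subst_word s (mkseq xi n.+1)) n.+1.
Proof.
move=> sa; rewrite /subst_string.
rewrite [mkseq _ n.+2]mkseqS /subst_word map_rcons flatten_rcons nth_cat.
have := size_subst_word_prolongable (mkseq (fun i => xi i.+1) n) sa.
suff -> : xi 0 :: mkseq (fun i => xi i.+1) n = mkseq xi n.+1.
  by rewrite /subst_word size_mkseq => ->.
by rewrite /mkseq /= -[1]addn0 iotaDl -map_comp.
Qed.

Lemma exists_unique_fixed_string s a : prolongable s a ->
  exists! xi, xi 0 = a /\ subst_string s xi = xi.
Proof.
move=> sa; have [_ /eqP sha _] := and3P sa.
pose p := fix p n := if n is m.+1 then
  rcons (p m) (nth a (subst_word s (p m)) m.+1) else [:: a].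
pose xi n := nth a (p n) n.
have sz_p n : size (p n) = n.+1 by elim: n => //= n IHn; rewrite size_rcons IHn.
have xiS n : xi n.+1 = nth a (subst_word s (p n)) n.+1.
  by rewrite /xi /= nth_rcons sz_p ltnn eqxx.
have pE n : p n = mkseq xi n.+1.
  by elim: n => [|n IHn] //; rewrite mkseqS -IHn xiS.
have xi0 : xi 0 = a by [].
exists xi; split.
  split=> //; apply/funext => -[|n].
    by rewrite /subst_string /subst_word /= xi0; case: (s a) sha => //= b w [->].
  by rewrite subst_string_prefix ?xi0 // -pE xiS.
move=> eta [eta0 etaE]; apply/funext => n.
elim/ltn_ind: n => -[_|n IHn]; first by rewrite eta0.
rewrite -[in RHS]etaE subst_string_prefix ?eta0 //.
have -> : mkseq eta n.+1 = mkseq xi n.+1.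
  apply/eq_in_map => i; rewrite mem_iota add0n => /andP[_ lti].
  by rewrite -IHn.
by rewrite -pE xiS.
Qed.

Definition fixed_string s a (sa : prolongable s a) : nat -> A :=
  sval (cid (exists_unique_fixed_string sa)).

Lemma fixed_stringP s a (sa : prolongable s a) :
  unique (fun xi => xi 0 = a /\ subst_string s xi = xi) (fixed_string sa).
Proof. exact: svalP (cid _). Qed.

End Substitution.

(* The alphabet {0,1} is [bool], with 0 = [false] and 1 = [true]. *)
Definition subst_TM (l : bool) : seq bool :=
  if l then [:: true; false] else [:: false; true].

Inductive letter_pd : Set := pd_x | pd_y.

Definition bool_of_pd l := if l is pd_x then false else true.
Definition pd_of_bool b := if b then pd_y else pd_x.
Lemma bool_of_pdK : cancel bool_of_pd pd_of_bool.
Proof. by case. Qed.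
HB.instance Definition _ := Countable.copy letter_pd (can_type bool_of_pdK).
HB.instance Definition _ : isFinite letter_pd := CanIsFinite bool_of_pdK.

Definition subst_pd (l : letter_pd) : seq letter_pd :=
  match l with pd_x => [:: pd_x; pd_y] | pd_y => [:: pd_x; pd_x] end.

Inductive letter_Mu : Set := Mu_a | Mu_c | Mu_d.

Definition option_of_Mu l :=
  match l with Mu_a => None | Mu_c => Some false | Mu_d => Some true end.
Definition Mu_of_option o :=
  match o with None => Mu_a | Some false => Mu_c | Some true => Mu_d end.
Lemma option_of_MuK : cancel option_of_Mu Mu_of_option.
Proof. by case. Qed.
HB.instance Definition _ := Countable.copy letter_Mu (can_type option_of_MuK).
HB.instance Definition _ : isFinite letter_Mu := CanIsFinite option_of_MuK.

Definition subst_Mu (l : letter_Mu) : seq letter_Mu :=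
  match l with
  | Mu_a => [:: Mu_a; Mu_c; Mu_a] | Mu_c => [:: Mu_d] | Mu_d => [:: Mu_c]
  end.

Lemma prolongable_TM : prolongable subst_TM false.
Proof. by apply/and3P; split=> //; apply/forallP; case. Qed.

Lemma prolongable_pd : prolongable subst_pd pd_x.
Proof. by apply/and3P; split=> //; apply/forallP; case. Qed.

Lemma prolongable_Mu : prolongable subst_Mu Mu_a.
Proof. by apply/and3P; split=> //; apply/forallP; case. Qed.

Definition xi_TM : nat -> bool := fixed_string prolongable_TM.
Definition xi_pd : nat -> letter_pd := fixed_string prolongable_pd.
Definition xi_Mu : nat -> letter_Mu := fixed_string prolongable_Mu.

(* Main.v *)
(* Both maps are sliding block codes. The letter of index n of the period
   doubling string is x exactly when the Thue-Morse string changes between n and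
   n + 1; a bi-infinite string is determined by its changes up to complement, and
   complementing preserves the language of the Thue-Morse string, so that code is
   two-to-one. The string of [xi_Mu] has a in alternate positions, and in the
   remaining ones the period doubling string with x, y renamed c, d. Its letter of
   index n is read off the letters of index n and n + 2 of the period doubling
   string, and conversely the latter is recovered by a, d -> x and c -> y. *)
Require Import Defs.
From mathcomp Require Import all_boot all_order all_algebra.
From mathcomp Require Import all_classical topology.
Set Implicit Arguments.
Unset Strict Implicit.
Unset Printing Implicit Defensive.

Import GRing.Theory.
Local Open Scope classical_set_scope.
Local Open Scope nat_scope.

(** * Sliding block codes between subshifts *)

Lemma OmegaP (A : finType) (xi : nat -> A) (om : bistring A) :
  Omega xi om <-> forall (k : int) (n : nat), exists j : nat,
    forall i : nat, i < n -> om (k + i%:Z)%R = xi (j + i).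
Proof.
split=> [h k n | h w [w0 [k wE]]].
  case: n => [|n]; first by exists 0.
  have [|_ [j jE]] := h (mkseq (fun i => om (k + i%:Z)%R) n.+1).
    by split=> //; exists k; rewrite size_mkseq.
  exists j => i ltin; have := congr1 (nth (om k) ^~ i) jE.
  by rewrite size_mkseq !nth_mkseq.
split=> //; have [j jE] := h k (size w); exists j; rewrite {1}wE.
by apply/eq_in_map => i; rewrite mem_iota add0n => /andP[_]; exact: jE.
Qed.

Lemma continuous_to_bistring (T : topologicalType) (A : finType)
    (f : T -> bistring A) :
  (forall x n, \forall y \near x, f y n = f x n) -> continuous f.
Proof.
move=> fE x; apply/cvg_sup => n; apply/cvg_image.
  by apply/seteqP; split=> // y _; exists (fun=> y).
move=> U nU; exists (fun h : bistring A => U (h n)).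
  by apply: filterS (fE x n) => y /= ->; exact: nbhs_singleton nU.
by apply/seteqP; split=> [y [h /= Uh <-]//|y Uy]; exists (fun=> y).
Qed.

Lemma near_coordinate (A : finType) (xi : nat -> A) (x : Omega xi) (n : int) :
  \forall y \near x, val y n = val x n.
Proof.
have cp := @proj_continuous int (fun=> discrete_topology A) n (val x).
have nx := cp [set val x n] (@discrete_set1 (discrete_topology A) (val x n)).
exact: (@initial_continuous _ _ (set_val : Omega xi -> bistring A) x _ nx).
Qed.

(** The codes of the proof read two letters at distance [r]: 1 for differences, 2 and 0 for the two
    directions of the conjugacy. *)
Definition slide (A B : finType) (c : A -> A -> B) (r : nat)
  (om : bistring A) : bistring B := fun n => c (om n) (om (n + r%:Z)%R).

Section Slide.
Context (A B : finType) (c : A -> A -> B) (r : nat).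
Context (xi : nat -> A) (eta : nat -> B).
Hypothesis etaE : forall n, eta n = c (xi n) (xi (n + r)).

Lemma Omega_slide om : Omega xi om -> Omega eta (slide c r om).
Proof.
(* An image window of length [n] depends on a window of length [n + r]. *)
move=> /OmegaP h; apply/OmegaP => k n; have [j jE] := h k (n + r).
exists j => i ltin; rewrite /slide etaE -addrA -PoszD -[j + i + r]addnA.
by rewrite !jE ?ltn_add2r // ltn_addr.
Qed.

Definition slide_map (x : Omega xi) : Omega eta :=
  exist _ (slide c r (val x)) (mem_set (Omega_slide (set_mem (valP x)))).

Lemma slide_map_continuous : continuous slide_map.
Proof.
apply: (@continuous_comp_initial _ _ _ (set_val : Omega eta -> _)).
apply: continuous_to_bistring => x n; near=> y.
rewrite /= /set_val /= /slide.
by congr c; near: y; exact: near_coordinate.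
Unshelve. all: by end_near. Qed.

Lemma slide_map_subshift x :
  slide_map (subshift xi x) = subshift eta (slide_map x).
Proof.
by apply: val_inj; apply/funext => n; rewrite /= /slide /shift addrAC.
Qed.

Lemma slide_map_factor :
  (forall y, exists x, slide_map x = y) ->
  factor_map (subshift eta) (subshift xi) slide_map.
Proof.
by split; [exact: slide_map_continuous | | exact: slide_map_subshift].
Qed.

End Slide.

(** * Fixed strings of substitutions *)

Section SubstString.
Context (A : finType) (s : A -> seq A).

Lemma nth_subst_word_uniform a q (w : seq A) n i :
    (forall b, size (s b) = q) -> n < size w -> i < q ->
  nth a (subst_word s w) (n * q + i) = nth a (s (nth a w n)) i.
Proof.
move=> sq + ltiq; rewrite /subst_word.
elim: w n => // b w IHw [|n] /= ltn; rewrite nth_cat sq ?ltiq //.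
by rewrite mulSn -addnA ltnNge leq_addr addKn IHw.
Qed.

Lemma fixed_string_uniform a (sa : prolongable s a) q n i :
    (forall b, size (s b) = q) -> i < q ->
  fixed_string sa (n * q + i) = nth a (s (fixed_string sa n)) i.
Proof.
move=> sq ltiq; have [[xi0 xiE] _] := fixed_stringP sa.
have q0 : 0 < q by apply: leq_trans ltiq.
have ltn : n < (n * q + i).+1 by rewrite ltnS (leq_trans (leq_pmulr n q0)) ?leq_addr.
rewrite -{1}xiE /subst_string (nth_subst_word_uniform _ sq) ?size_mkseq //.
by rewrite nth_mkseq // xi0.
Qed.

(* A prefix of [subst_string s xi] may be read off the image of any longer
   prefix of [xi]. *)
Lemma subst_string_fixed xi p q : nonerasing s -> 0 < p -> 0 < q ->
    (forall m, subst_word s (mkseq xi (m * p)) = mkseq xi (m * q)) ->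
  subst_string s xi = xi.
Proof.
move=> s0 p0 q0 h; apply/funext => n; rewrite /subst_string.
have ltn r : 0 < r -> n < n.+1 * r := @leq_pmulr n.+1 r.
have := congr1 (nth (xi 0) ^~ n) (h n.+1).
rewrite [in RHS]nth_mkseq ?ltn // => <-.
rewrite -(subnKC (ltn p p0)) /mkseq iotaD map_cat /subst_word map_cat flatten_cat.
rewrite nth_cat; case: ifP => // /negbT/negP[].
by have := size_subst_word (mkseq xi n.+1) s0; rewrite size_mkseq.
Qed.

End SubstString.

(** * Thue-Morse differences and period doubling *)

Lemma subst_TM_size b : size (subst_TM b) = 2. Proof. by case: b. Qed.

Lemma subst_pd_size b : size (subst_pd b) = 2. Proof. by case: b. Qed.

Lemma xi_TM_double n : xi_TM n.*2 = xi_TM n.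
Proof.
rewrite -muln2 -[n * 2]addn0 /xi_TM (fixed_string_uniform _ _ subst_TM_size) //.
by case: (fixed_string _ n).
Qed.

Lemma xi_TM_doubleS n : xi_TM n.*2.+1 = ~~ xi_TM n.
Proof.
rewrite -muln2 -addn1 /xi_TM (fixed_string_uniform _ _ subst_TM_size) //.
by case: (fixed_string _ n).
Qed.

Lemma xi_pd_double n : xi_pd n.*2 = pd_x.
Proof.
rewrite -muln2 -[n * 2]addn0 /xi_pd (fixed_string_uniform _ _ subst_pd_size) //.
by case: (fixed_string _ n).
Qed.

Lemma xi_pd_doubleS n : xi_pd n.*2.+1 = if xi_pd n is pd_x then pd_y else pd_x.
Proof.
rewrite -muln2 -addn1 /xi_pd (fixed_string_uniform _ _ subst_pd_size) //.
by case: (fixed_string _ n).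
Qed.

Lemma xi_pd_even n : ~~ odd n -> xi_pd n = pd_x.
Proof. by move=> on; rewrite -[n]odd_double_half (negbTE on) xi_pd_double. Qed.

Definition diff_code (u v : bool) : letter_pd := if u == v then pd_y else pd_x.

(** The blocks 01 and 10 always change inside. Across the boundary of blocks [n] and [n + 1] the
    letters are [~~ xi_TM n] and [xi_TM (n + 1)], so a change there means no change at [n], which is
    the rule for odd letters of [xi_pd]. *)
Lemma xi_pd_diff n : xi_pd n = diff_code (xi_TM n) (xi_TM (n + 1)).
Proof.
rewrite addn1; elim/ltn_ind: n => n IHn.
case on : (odd n); rewrite -(odd_double_half n) on /=; last first.
  rewrite add0n xi_pd_double xi_TM_double xi_TM_doubleS /diff_code.
  by case: (xi_TM _).
rewrite add1n -doubleS xi_pd_doubleS xi_TM_doubleS xi_TM_double IHn.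
  by rewrite /diff_code; case: (xi_TM _); case: (xi_TM _).
by rewrite -[n in _ < n]odd_double_half on add1n ltnS -addnn leq_addr.
Qed.

(** Halving both positions reduces [m]. This makes the complement of every prefix occur in
    [xi_TM]. *)
Lemma xi_TM_add_pow2 m k : k < 2 ^ m -> xi_TM (2 ^ m + k) = ~~ xi_TM k.
Proof.
elim: m k => [|m IHm] k.
  by rewrite expn0 ltnS leqn0 => /eqP ->; exact: (xi_TM_doubleS 0).
rewrite expnS mul2n => ltk; have lth : k./2 < 2 ^ m by rewrite ltn_half_double.
rewrite -(odd_double_half k); case: (odd k); last first.
  by rewrite add0n -doubleD !xi_TM_double IHm.
by rewrite add1n addnS -doubleD !xi_TM_doubleS IHm.
Qed.

(* Words of [xi_TM] with the same differences are equal or complementary, and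
   the language of [xi_TM] is closed under complement; hence [Omega xi_TM] is
   the full preimage of [Omega xi_pd]. *)
Lemma Omega_TM_of_diff (om : bistring bool) :
  Omega xi_pd (slide diff_code 1 om) -> Omega xi_TM om.
Proof.
move=> /OmegaP h; apply/OmegaP => k n; have [j jE] := h k n.
have cst i : i < n -> om (k + i%:Z)%R (+) xi_TM (j + i) = om k (+) xi_TM j.
  elim: i => [|i IHi] lin; first by rewrite addr0 addn0.
  rewrite -IHi ?(ltnW lin) //.
  have := jE i (ltnW lin); rewrite xi_pd_diff /slide -addrA -PoszD.
  rewrite -addnA addn1 /diff_code.
  by case: (om _); case: (om _); case: (xi_TM _); case: (xi_TM _).
have [e|e] := boolP (om k == xi_TM j).
  exists j => i /cst; rewrite (eqP e) addbb.
  by case: (om _); case: (xi_TM _).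
(* The power exceeds every position [j + i] of the window, so this translation complements the whole
   word. *)
exists (2 ^ (j + n) + j) => i lin; rewrite -addnA xi_TM_add_pow2; last first.
  by apply: (@ltn_trans (j + n)); rewrite ?ltn_add2l // ltn_expl.
move: (cst i lin) e.
by case: (om _); case: (xi_TM _); case: (om _); case: (xi_TM _).
Qed.

Lemma diff_code_eqP (om om' : bistring bool) :
    slide diff_code 1 om = slide diff_code 1 om' ->
  om' = om \/ om' = (fun n => ~~ om n).
Proof.
(* Equal differences make the sum of the two strings modulo 2 shift-invariant, hence constant. *)
move=> e; have step n :
    om n (+) om' n = om (n + 1)%R (+) om' (n + 1)%R.
  have := congr1 (@^~ n) e; rewrite /slide /diff_code.
  by case: (om _); case: (om _); case: (om' _); case: (om' _).
have cst n : om n (+) om' n = om 0%R (+) om' 0%R.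
  elim/int_rect: n => // n IHn; first by rewrite intS addrC -step.
  by rewrite intS opprD addrC step subrK.
have [e0|e0] := boolP (om 0%R (+) om' 0%R); [right|left].
  by apply/funext => n; move: (cst n); rewrite e0; case: (om n); case: (om' n).
apply/funext => n; move: (cst n); rewrite (negbTE e0).
by case: (om n); case: (om' n).
Qed.

Lemma diff_code_surj (eta : bistring letter_pd) :
  exists om, slide diff_code 1 om = eta.
Proof.
pose d n := eta n == pd_x.
(* Starting from [false] at 0, the letter at [n] is the parity of the number of changes between 0
   and [n]; [Negz m] is -(m+1), whence [m.+1] terms. *)
exists (fun n => match n with
  | Posz m => \big[addb/false]_(i < m) d (Posz i)
  | Negz m => \big[addb/false]_(i < m.+1) d (Negz i) end).
apply/funext => -[m|m]; rewrite /slide /diff_code.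
  rewrite -PoszD addn1 big_ord_recr /= /d.
  by case: (\big[_/_]_(_ < _) _); case: (eta _).
case: m => [|m].
  by rewrite /= big_ord_recr !big_ord0 /= /d; case: (eta _).
have -> : (Negz m.+1 + 1)%R = Negz m by rewrite !NegzE intS opprD addrC addNKr.
rewrite big_ord_recr /= /d.
by case: (\big[_/_]_(_ < _) _); case: (eta _).
Qed.

(** * The string [xi_Mu] as a recoding of [xi_pd] *)

Definition Mu_of_pd (l : letter_pd) : letter_Mu :=
  if l is pd_x then Mu_c else Mu_d.

Lemma xi_MuE n :
  xi_Mu n = if odd n then Mu_of_pd (xi_pd n./2) else Mu_a.
Proof.
pose mu n := if odd n then Mu_of_pd (xi_pd n./2) else Mu_a.
suff -> : xi_Mu = mu by [].
apply: (fixed_stringP prolongable_Mu).2; split=> //.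
(* Each pair, a followed by c or d, has an image of length 4: aca followed by the other letter. *)
apply: (@subst_string_fixed _ _ _ 2 4) => //; first by case/and3P: prolongable_Mu.
elim=> // m IHm; rewrite !mulSn ![_ + m * _]addnC /mkseq !iotaD !map_cat.
rewrite /subst_word map_cat flatten_cat -/(mkseq _ _) [flatten _]IHm; congr cat.
rewrite /= /mu /= !oddM !andbF /= !muln2.
rewrite (_ : m * 4 = m.*2.*2) ?odd_double /= ?doubleK ?uphalf_double.
  by rewrite xi_pd_double xi_pd_doubleS; case: (xi_pd m).
by rewrite -!muln2 -mulnA.
Qed.

Definition pd_Mu_code (u v : letter_pd) : letter_Mu :=
  match u, v with
  | pd_y, _ => Mu_c
  | pd_x, pd_x => Mu_a
  | pd_x, pd_y => Mu_d
  end.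

Definition Mu_pd_code (u _ : letter_Mu) : letter_pd :=
  if u is Mu_c then pd_y else pd_x.

(** At even [n] both letters read are x. At odd [n] with half [k], y at [n] means x at [k], giving
    c; x at [n] means y at [k], so [k] is odd, [k + 1] carries x and [n + 2] carries y, giving d. *)
Lemma xi_Mu_code n : xi_Mu n = pd_Mu_code (xi_pd n) (xi_pd (n + 2)).
Proof.
rewrite xi_MuE addn2; case on : (odd n); last first.
  by rewrite !xi_pd_even //= on.
rewrite -(odd_double_half n) on /= add1n -doubleS !xi_pd_doubleS uphalf_double.
case e : (xi_pd n./2) => //=.
by rewrite (xi_pd_even (n := _.+1)) //= negbK; apply: contraT => /xi_pd_even;
  rewrite e.
Qed.

Lemma xi_pd_code n : xi_pd n = Mu_pd_code (xi_Mu n) (xi_Mu (n + 0)).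
Proof. by rewrite !xi_Mu_code; case: (xi_pd n); case: (xi_pd (n + 2)). Qed.

(** This fails for general strings, such as the constant d; on [Omega xi_Mu] each window of three
    letters inherits it from [xi_Mu]. *)
Lemma Mu_pd_codeK om : Omega xi_Mu om ->
  slide pd_Mu_code 2 (slide Mu_pd_code 0 om) = om.
Proof.
move=> /OmegaP h; apply/funext => n; have [j jE] := h n 3.
rewrite /slide !jE //; have := jE 0 isT; rewrite addr0 => ->.
rewrite addn0 [RHS]xi_Mu_code; congr pd_Mu_code; symmetry; exact: xi_pd_code.
Qed.

Lemma pd_Mu_codeK (om : bistring letter_pd) :
  slide Mu_pd_code 0 (slide pd_Mu_code 2 om) = om.
Proof.
apply/funext => n; rewrite /slide.
by case: (om n); case: (om (n + 2%:Z)%R).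
Qed.

(** * Fibres of the difference code, and the conjugacy *)

Theorem proposition2p16 :
  two_to_one_continuous_factor (subshift xi_pd) (subshift xi_TM) /\
  topologically_conjugate (subshift xi_Mu) (subshift xi_pd).
Proof.
split.
  have lift (om : bistring bool) (y : Omega xi_pd) :
      slide diff_code 1 om = val y ->
      exists2 x : Omega xi_TM, val x = om & slide_map xi_pd_diff x = y.
    move=> omE.
    have Oom : Omega xi_TM om.
      by apply: Omega_TM_of_diff; rewrite omE; exact: set_mem (valP y).
    by exists (exist _ om (mem_set Oom)) => //; exact: val_inj.
  exists (slide_map xi_pd_diff); split.
    apply: slide_map_factor => y; have [om omE] := diff_code_surj (val y).
    by have [x _ xE] := lift _ _ omE; exists x.
  move=> y; have [om omE] := diff_code_surj (val y).
  have [x xom xE] := lift _ _ omE.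
  (* Complementing changes no difference, which yields the second preimage. *)
  have omE' : slide diff_code 1 (fun n => ~~ om n) = val y.
    rewrite -omE; apply/funext => n; rewrite /slide /diff_code.
    by case: (om _); case: (om _).
  have [x' x'om x'E] := lift _ _ omE'.
  exists x, x'; split.
    move=> xx'; have := congr1 (@^~ 0%R) x'om; rewrite -xx' xom.
    by case: (om _).
  apply/seteqP; split=> [z /= zE|z /= [->|->]//].
  have /diff_code_eqP[] : slide diff_code 1 om = slide diff_code 1 (val z).
  - by rewrite omE -zE.
  - by move=> zom; left; apply: val_inj; rewrite xom.
  - by move=> zom; right; apply: val_inj; rewrite x'om.
have K1 : cancel (slide_map xi_Mu_code) (slide_map xi_pd_code).
  by move=> y; apply: val_inj; exact: pd_Mu_codeK.
have K2 : cancel (slide_map xi_pd_code) (slide_map xi_Mu_code).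
  by move=> x; apply: val_inj; apply: Mu_pd_codeK; exact: set_mem (valP x).
exists (slide_map xi_Mu_code); split.
  by apply: slide_map_factor => x; exists (slide_map xi_pd_code x).
split; first exact: slide_map_continuous.
by exists (slide_map xi_pd_code); split=> //; exact: slide_map_continuous.
Qed.
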